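(* The Pell-Narayana length of the binary polyhedral group $\langle 2,2,2\rangle=\langle x,y : x^2=y^2=(xy)^2\rangle$, for the generating pair $(x,y)$, is $6$.
   Context: For integers $\ell,m,n>1$, the binary polyhedral group $\langle \ell,m,n\rangle$ is defined by the presentation $\langle x,y : x^\ell=y^m=(xy)^n\rangle$ (equivalently $\langle x,y,z : x^\ell=y^m=z^n=xyz\rangle$). For a finite group $G$ generated by a pair $(x,y)$, the Pell-Narayana orbit of $G$ for $(x,y)$ is the sequence $(s_n)_{n\ge 0}$ in $G$ given by $s_0=x$, $s_1=y$, $s_2=y^2$, and $s_n=s_{n-3}(s_{n-1})^2$ for $n\ge 3$. The Pell-Narayana length of $G$ for $(x,y)$ is the period of this orbit, i.e. the least integer $k\ge 1$ such that $s_{n+k}=s_n$ for all $n\ge 0$. *)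

(* Defs.v *)
From HB Require Import structures.
From mathcomp Require Import all_boot.
From mathcomp Require Import boolp classical_sets cardinality.

Set Implicit Arguments.
Unset Strict Implicit.
Unset Printing Implicit Defensive.

Local Open Scope classical_set_scope.
Local Open Scope group_scope.
Local Open Scope quotient_scope.

Section Presentation.
Variables (I : choiceType) (rels : seq (seq (I * bool) * seq (I * bool))).

(* A letter (i, b) stands for the generator i if b = false and for its inverse
   if b = true; a pair (u, v) in rels stands for the relation u = v. *)
Inductive pres_eqv : seq (I * bool) -> seq (I * bool) -> Prop :=
| pres_refl u : pres_eqv u u
| pres_sym u v : pres_eqv u v -> pres_eqv v u
| pres_trans u v w : pres_eqv u v -> pres_eqv v w -> pres_eqv u w
| pres_cat u u' v v' :
    pres_eqv u u' -> pres_eqv v v' -> pres_eqv (u ++ v) (u' ++ v')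
| pres_cancel i b : pres_eqv [:: (i, b); (i, ~~ b)] [::]
| pres_rel u v : (u, v) \in rels -> pres_eqv u v.

Definition pres_eqb : rel (seq (I * bool)) := fun u v => `[< pres_eqv u v >].

Lemma pres_eqb_refl : reflexive pres_eqb.
Proof. by move=> u; apply/asboolP; exact: pres_refl. Qed.

Lemma pres_eqb_sym : symmetric pres_eqb.
Proof. by move=> u v; apply/asboolP/asboolP; exact: pres_sym. Qed.

Lemma pres_eqb_trans : transitive pres_eqb.
Proof.
by move=> v u w /asboolP uv /asboolP vw; apply/asboolP; exact: pres_trans uv vw.
Qed.

Canonical pres_equiv :=
  EquivRel pres_eqb pres_eqb_refl pres_eqb_sym pres_eqb_trans.

(* The group < I | rels >. *)
Definition presented : Type := {eq_quot pres_equiv}.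
HB.instance Definition _ := Choice.on presented.
HB.instance Definition _ := EqQuotient.on presented.

Definition inv_word (u : seq (I * bool)) : seq (I * bool) :=
  rev [seq (p.1, ~~ p.2) | p <- u].

Definition pres_one : presented := \pi_presented [::].
Definition pres_mul (g h : presented) : presented := \pi_presented (repr g ++ repr h).
Definition pres_inv (g : presented) : presented := \pi_presented (inv_word (repr g)).

Lemma pres_piP u v : reflect (pres_eqv u v) (\pi_presented u == \pi_presented v).
Proof. by rewrite eqmodE; exact: asboolP. Qed.

Lemma pres_repr u : pres_eqv (repr (\pi_presented u)) u.
Proof. by apply/pres_piP; rewrite reprK. Qed.

Lemma inv_word_cat u v : inv_word (u ++ v) = inv_word v ++ inv_word u.
Proof. by rewrite /inv_word map_cat rev_cat. Qed.

Lemma inv_wordK : involutive inv_word.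
Proof.
move=> u; rewrite /inv_word map_rev revK -map_comp -[RHS]map_id.
by apply: eq_map => -[i b] /=; rewrite negbK.
Qed.

Lemma pres_catV u : pres_eqv (u ++ inv_word u) [::].
Proof.
elim: u => [|[i b] u IHu]; first exact: pres_refl.
rewrite -cat1s inv_word_cat -catA; set a := [:: (i, b)].
apply: (pres_trans (v := a ++ ([::] ++ inv_word a))); last exact: pres_cancel.
apply: pres_cat; first exact: pres_refl.
by rewrite catA; apply: pres_cat => //; exact: pres_refl.
Qed.

Lemma pres_catVl u : pres_eqv (inv_word u ++ u) [::].
Proof. by rewrite -{2}[u]inv_wordK; exact: pres_catV. Qed.

Lemma pi_mul u v : pres_mul (\pi u) (\pi v) = \pi_presented (u ++ v).
Proof. by apply/eqP/pres_piP; apply: pres_cat; exact: pres_repr. Qed.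

Lemma pres_mulA : associative pres_mul.
Proof.
by elim/quotW=> u; elim/quotW=> v; elim/quotW=> w; rewrite !pi_mul catA.
Qed.

Lemma pres_mul1g : left_id pres_one pres_mul.
Proof. by elim/quotW=> u; rewrite pi_mul. Qed.

Lemma pres_mulg1 : right_id pres_one pres_mul.
Proof. by elim/quotW=> u; rewrite pi_mul cats0. Qed.

Lemma pres_mulVg : left_inverse pres_one pres_inv pres_mul.
Proof.
by move=> g; rewrite -{2}[g]reprK pi_mul; apply/eqP/pres_piP/pres_catVl.
Qed.

Lemma pres_mulgV : right_inverse pres_one pres_inv pres_mul.
Proof.
by move=> g; rewrite -{1}[g]reprK pi_mul; apply/eqP/pres_piP/pres_catV.
Qed.

HB.instance Definition _ := isGroup.Build presented
  pres_mulA pres_mul1g pres_mulg1 pres_mulVg pres_mulgV.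

Definition pres_gen (i : I) : presented := \pi_presented [:: (i, false)].

End Presentation.

(* Words over two generators, x = false and y = true. *)
Definition word_x : seq (bool * bool) := [:: (false, false)].
Definition word_y : seq (bool * bool) := [:: (true, false)].
Definition word_exp (u : seq (bool * bool)) (n : nat) : seq (bool * bool) :=
  flatten (nseq n u).

Definition binary_polyhedral_rels (l m n : nat) :=
  [:: (word_exp word_x l, word_exp word_y m);
      (word_exp word_y m, word_exp (word_x ++ word_y) n)].

(* The group < x, y : x^l = y^m = (xy)^n >; only l, m, n > 1 are of interest. *)
Definition binary_polyhedral (l m n : nat) : groupType :=
  presented (binary_polyhedral_rels l m n).
Definition bp_x (l m n : nat) : binary_polyhedral l m n :=
  pres_gen (binary_polyhedral_rels l m n) false.
Definition bp_y (l m n : nat) : binary_polyhedral l m n :=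
  pres_gen (binary_polyhedral_rels l m n) true.

Definition generated_by (G : groupType) (x y : G) : Prop :=
  forall S : {pred G}, group_closed S -> x \in S -> y \in S ->
  forall z, z \in S.

Fixpoint pell_narayana (G : groupType) (x y : G) (n : nat) : G :=
  match n with
  | 0 => x
  | 1 => y
  | 2 => y ^+ 2
  | S (S (S k) as k2) => pell_narayana x y k * (pell_narayana x y k2) ^+ 2
  end.

Definition pell_narayana_period (G : groupType) (x y : G) (k : nat) : Prop :=
  forall n, pell_narayana x y (n + k)%N = pell_narayana x y n.

(* The length is only defined for a finite group and a generating pair, so
   these two conditions are part of saying that it equals k. *)
Definition pell_narayana_length (G : groupType) (x y : G) (k : nat) : Prop :=
  [/\ finite_set [set: G], generated_by x y, (0 < k)%N,
      pell_narayana_period x y k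
    & forall k', (0 < k')%N -> pell_narayana_period x y k' -> (k <= k')%N].

(* Main.v *)
(** Write c = x^2 = y^2 = (xy)^2. The relations give xyx = y and yxy = x, so c
    is central, c^2 = 1 and yx = cxy; hence every element of <2,2,2> is
    c^s x^a y^b with s, a, b in {0,1}. Right multiplication by x and y on these
    eight normal forms satisfies the relations, so the normal forms are distinct
    and the word problem is decided by computing the normal form. The orbit is
    then x, y, c, x, cy, 1, x, y, c, ..., and no shift by less than 6 works. *)
From mathcomp Require Import all_boot.
From mathcomp Require Import boolp classical_sets cardinality.
Require Import Defs.

Set Implicit Arguments.
Unset Strict Implicit.
Unset Printing Implicit Defensive.

Local Open Scope group_scope.
Local Open Scope quotient_scope.

Section NormalForm.

(* The triple (s, a, b) stands for the normal form c^s x^a y^b. *)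
Definition q8_act (p : bool * bool * bool) (l : bool * bool) :
    bool * bool * bool :=
  let: (s, a, b) := p in
  if l.1 then (s (+) b (+) l.2, a, ~~ b) else (s (+) a (+) b (+) l.2, ~~ a, b).

Definition q8_nf (u : seq (bool * bool)) : bool * bool * bool :=
  foldl q8_act (false, false, false) u.

(** The start [p] is arbitrary because, in a concatenation, the second word acts on whatever state
    the first one leaves. *)
Lemma q8_act_eqv u v : pres_eqv (binary_polyhedral_rels 2 2 2) u v ->
  forall p, foldl q8_act p u = foldl q8_act p v.
Proof.
elim=> {u v} //=.
- by move=> u v w _ IH1 _ IH2 p; rewrite IH1.
- by move=> u u' v v' _ IH1 _ IH2 p; rewrite !foldl_cat IH1.
- by move=> [] [] [[[] []] []].
- by move=> u v; rewrite !inE => /orP[] /eqP[-> ->] [[[] []] []].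
Qed.

Variables (G : groupType) (x y : G).

Definition q8_val (p : bool * bool * bool) : G :=
  let: (s, a, b) := p in (y * y) ^+ s * x ^+ a * y ^+ b.

Hypothesis xxE : x * x = y * y.
Hypothesis xyxyE : y * y = x * y * (x * y).

Lemma q8_val_act p (l : bool * bool) :
  let z := if l.1 then y else x in
  q8_val (q8_act p l) = q8_val p * (if l.2 then z^-1 else z).
Proof.
have xyx : x * y * x = y by apply: (mulIg y); rewrite xyxyE !mulgA.
have yxy : y * x * y = x by apply: (mulgI x); rewrite xxE xyxyE !mulgA.
rewrite /q8_val; move c_def : (y * y) => c.
have xx : x * x = c by rewrite xxE.
have xc : x * c = c * x by rewrite -xx mulgA.
have yc : y * c = c * y by rewrite -c_def mulgA.
have xcA g : x * (c * g) = c * (x * g) by rewrite mulgA xc mulgA.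
have ycA g : y * (c * g) = c * (y * g) by rewrite mulgA yc mulgA.
have xxA g : x * (x * g) = c * g by rewrite mulgA xx.
have yyA g : y * (y * g) = c * g by rewrite mulgA c_def.
(* Squaring y = xyx gives c = xy(xx)yx = c^3, and one c cancels. *)
have cc : c * c = 1.
  apply: (mulIg c); rewrite mul1g -[RHS]c_def -xyx.
  by rewrite -!mulgA xxA ycA yyA !xcA xx.
have yx : y * x = c * (x * y).
  by apply: (mulIg y); rewrite yxy -!mulgA c_def xc mulgA cc mul1g.
have ccA g : c * (c * g) = g by rewrite mulgA cc mul1g.
have yxA g : y * (x * g) = c * (x * (y * g)) by rewrite mulgA yx -!mulgA.
have xV : x^-1 = c * x by apply: (mulIg x); rewrite mulVg -mulgA xx cc.
have yV : y^-1 = c * y by apply: (mulIg y); rewrite mulVg -mulgA c_def cc.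
case: p l => [[s a] b] [[] []]; case: s a b => [] [] [] /=;
  rewrite ?expg1 ?expg0 ?xV ?yV -?mulgA ?(mul1g, mulg1) //;
  by rewrite ?(cc, xc, yc, xx, c_def, yx, ccA, xcA, ycA, xxA, yyA, yxA,
               mul1g, mulg1).
Qed.

End NormalForm.

Local Notation Q8 := (binary_polyhedral 2 2 2).

Lemma pi_mulg (u v : seq (bool * bool)) :
  (\pi_Q8 u : Q8) * \pi_Q8 v = \pi_Q8 (u ++ v).
Proof. exact: pi_mul. Qed.

Lemma pi_letter g b :
  \pi_Q8 [:: (g, b)] =
    (if b then (if g then bp_y 2 2 2 else bp_x 2 2 2)^-1
     else if g then bp_y 2 2 2 else bp_x 2 2 2) :> Q8.
Proof.
have -> : (if g then bp_y 2 2 2 else bp_x 2 2 2) = \pi_Q8 [:: (g, false)] :> Q8.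
  by case: g.
case: b => //; apply: (mulIg (\pi_Q8 [:: (g, false)] : Q8)).
by rewrite mulVg pi_mulg; apply/eqP/pres_piP; exact: pres_cancel.
Qed.

Lemma pi_q8_val u : \pi_Q8 u = q8_val (bp_x 2 2 2) (bp_y 2 2 2) (q8_nf u).
Proof.
have xxE : bp_x 2 2 2 * bp_x 2 2 2 = bp_y 2 2 2 * bp_y 2 2 2.
  by rewrite !pi_mulg; apply/eqP/pres_piP; exact: pres_rel.
have xyxyE : bp_y 2 2 2 * bp_y 2 2 2 =
    bp_x 2 2 2 * bp_y 2 2 2 * (bp_x 2 2 2 * bp_y 2 2 2).
  by rewrite !(pi_mulg word_x word_y, pi_mulg word_y word_y) pi_mulg;
    apply/eqP/pres_piP; exact: pres_rel.
(* Letters are split off at the right end, where [foldl] applies its last action. *)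
elim/last_ind: u => [|u [g b] IHu]; first by rewrite /= !mulg1.
by rewrite -cats1 -pi_mulg IHu pi_letter /q8_nf foldl_cat /= q8_val_act.
Qed.

(** This replaces equality in the quotient, which rests on a classical [asbool] and does not reduce,
    by a boolean test that computes. *)
Lemma pi_q8_nf u v : (\pi_Q8 u == \pi_Q8 v) = (q8_nf u == q8_nf v).
Proof.
apply/idP/eqP => [/pres_piP uv | uv]; first exact: q8_act_eqv.
by rewrite !pi_q8_val uv.
Qed.

(** A lift of the orbit to unreduced words. Only indices up to 8 get evaluated, so at most 258
    letters occur. *)
Fixpoint pell_narayana_word (n : nat) : seq (bool * bool) :=
  match n with
  | 0 => word_x
  | 1 => word_y
  | 2 => word_y ++ word_y
  | S (S (S k) as k2) =>
      pell_narayana_word k ++ (pell_narayana_word k2 ++ pell_narayana_word k2)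
  end.

Lemma pell_narayana_pi n :
  pell_narayana (bp_x 2 2 2) (bp_y 2 2 2) n = \pi_Q8 (pell_narayana_word n).
Proof.
elim/ltn_ind: n => -[|[|[|n]]] // IHn; first by rewrite /= expg2 pi_mulg.
have -> : pell_narayana (bp_x 2 2 2) (bp_y 2 2 2) n.+3 =
  pell_narayana (bp_x 2 2 2) (bp_y 2 2 2) n *
  pell_narayana (bp_x 2 2 2) (bp_y 2 2 2) n.+2 ^+ 2 by [].
rewrite (IHn n) ?ltnS ?leqW // (IHn n.+2) // expg2.
by rewrite (pi_mulg (pell_narayana_word n.+2)) pi_mulg.
Qed.

Lemma pell_narayana_eqE m n :
  (pell_narayana (bp_x 2 2 2) (bp_y 2 2 2) m ==
   pell_narayana (bp_x 2 2 2) (bp_y 2 2 2) n) =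
  (q8_nf (pell_narayana_word m) == q8_nf (pell_narayana_word n)).
Proof. by rewrite !pell_narayana_pi; exact: pi_q8_nf. Qed.

(** The recurrence reaches back three places, so agreement on three initial terms propagates. *)
Lemma pell_narayana_period_init (G : groupType) (x y : G) k :
  (forall n, (n < 3)%N -> pell_narayana x y (n + k) = pell_narayana x y n) ->
  pell_narayana_period x y k.
Proof.
move=> init; elim/ltn_ind => -[|[|[|n]]] IHn; try exact: init.
have rec m : pell_narayana x y m.+3 =
  pell_narayana x y m * pell_narayana x y m.+2 ^+ 2 by [].
by rewrite !addSn !rec -!addSn !IHn ?ltnS ?leqW.
Qed.

Theorem theorem22 :
  @pell_narayana_length (binary_polyhedral 2 2 2) (bp_x 2 2 2) (bp_y 2 2 2) 6.
Proof.
split=> //.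
(* The group is covered by the values of the eight triples. *)
- apply: (@sub_finite_set _ _ (range (q8_val (bp_x 2 2 2) (bp_y 2 2 2)))).
    by elim/quotW=> u _; rewrite pi_q8_val; exists (q8_nf u).
  exact/finite_image/finite_finset.
- move=> S S_group xS yS; elim/quotW; elim=> [|[g b] u IHu]; first exact: S_group.1.
  rewrite -cat1s -pi_mulg; apply: group_closedM => //.
  by rewrite pi_letter; case: b; case: g => //; apply: group_closedV.
- by apply: pell_narayana_period_init => -[|[|[|]]] // _;
    apply/eqP; rewrite pell_narayana_eqE.
- move=> k' k'_gt0 per; rewrite leqNgt; apply/negP => k'_lt6.
  (* Index 0 alone does not exclude the shift 3, since s_3 = x; index 1 does, since s_4 = cy differs
     from y. *)
  have /eqP := per 0%N; have /eqP := per 1%N; have /eqP := per 2%N.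
  rewrite !pell_narayana_eqE.
  by case: k' k'_gt0 k'_lt6 {per} => [|[|[|[|[|[|]]]]]].
Qed.
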